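(* Let $M\subset\mathbb{R}^p$ be the parameter space and let $\Sigma_h,U_h,R_h$, $B:\Sigma_h\to U_h'\times R_h'$, $f_{\mu}\in U_h'\times R_h'$, the discrete stress solutions $\sigma_{\mu}\in\Sigma_h$ ($\mu\in M$), the linear right-inverse $S_I:U_h'\times R_h'\to\Sigma_h$ of $B$, and $S_0:=I-S_IB:\Sigma_h\to\Sigma_h$ be as described in the context. Let $\|\cdot\|$ denote the $\ell^2$-norm on $\Sigma_h$ (the Euclidean norm of the coefficient vector). Let $V_0\subseteq S_0(\Sigma_h)=\ker B$ be a linear subspace and let $\pi_0:\Sigma_h\to V_0$ be the orthogonal projection onto $V_0$ in the $\ell^2$ inner product. Define $$\epsilon:=\sup_{\mu\in M}\|(I-\pi_0)S_0\sigma_{\mu}\|,$$ and let the correction map $C:\Sigma_h\times M\to\Sigma_h$ be given by $$C(\tilde\sigma,\mu):=\pi_0\left(\tilde\sigma-S_If_{\mu}\right)+S_If_{\mu}.$$ Then, for all $\tilde\sigma\in\Sigma_h$ and all $\mu\in M$: (i) $B\,C(\tilde\sigma,\mu)=f_{\mu}$; (ii) $\|\sigma_{\mu}-C(\tilde\sigma,\mu)\|\le\|\sigma_{\mu}-\tilde\sigma\|+\epsilon$.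
   Context: Domain and spaces. $\Omega\subset\mathbb{R}^d$, $d\in\{2,3\}$, is a Lipschitz polytopal domain with outward unit normal $\nu$, whose boundary is disjointly partitioned as $\partial\Omega=\partial_u\Omega\cup\partial_\sigma\Omega$ with $|\partial_u\Omega|>0$. $\Omega_h$ is a shape-regular simplicial mesh of $\Omega$. The finite-dimensional spaces are $$\Sigma_h:=\{\sigma_h\in\mathbb{BDM}_1^d(\Omega_h):\ \nu\cdot\sigma_h=0\text{ on }\partial_\sigma\Omega\},\quad U_h:=\mathbb{P}_0^d(\Omega_h),\quad R_h:=\mathbb{P}_0^{\binom d2}(\Omega_h),$$ where $\mathbb{BDM}_1^d$ denotes $d\times d$ matrix fields with each row in the lowest-order Brezzi-Douglas-Marini space, and $\mathbb{P}_0$ denotes piecewise constants. Primes denote dual spaces. Each element of $\Sigma_h$ is identified with its vector of finite element coefficients in $\mathbb{R}^{N_h}$, $N_h=\dim\Sigma_h$; the $\ell^2$ inner product and norm on $\Sigma_h$ are the Euclidean ones on these coefficient vectors. The operator $\mathrm{asym}:\mathbb{R}^{d\times d}\to\mathbb{R}^{\binom d2}$ is $\mathrm{asym}\,\sigma=\sigma_{21}-\sigma_{12}$ for $d=2$ and $\mathrm{asym}\,\sigma=(\sigma_{32}-\sigma_{23},\ \sigma_{13}-\sigma_{31},\ \sigma_{21}-\sigma_{12})^\top$ for $d=3$. The divergence of a matrix field is taken row-wise. $\langle\cdot,\cdot\rangle_\Omega$ and $\langle\cdot,\cdot\rangle_{\partial_u\Omega}$ are $L^2$ inner products. Constraint operator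 and functional. $B:\Sigma_h\to U_h'\times R_h'$ is the linear operator $$\langle B\sigma_h,(\tilde u_h,\tilde r_h)\rangle:=-\langle\nabla\cdot\sigma_h,\tilde u_h\rangle_\Omega+\langle\mathrm{asym}\,\sigma_h,\tilde r_h\rangle_\Omega,$$ which is surjective. For each $\mu\in M$, $f_{\mu}\in U_h'\times R_h'$ is given by $\langle f_{\mu},(\tilde u_h,\tilde r_h)\rangle:=\langle f_{u,\mu},\tilde u_h\rangle_\Omega$, where $f_{u,\mu}$ is a (parameter-dependent) body force. $B$ and the spaces do not depend on $\mu$. Discrete solutions. For each $\mu\in M$, $A_{\mu}:\mathbb{R}^{d\times d}\to\mathbb{R}^{d\times d}$ is a (possibly non-linear) stress-strain relation and $g_{u,\mu}$ is a prescribed boundary displacement on $\partial_u\Omega$. It is assumed that for each $\mu\in M$ the problem is well posed, and $(\sigma_{\mu},u_{\mu},r_{\mu})\in\Sigma_h\times U_h\times R_h$ denotes its discrete solution, i.e. for all $(\tilde\sigma_h,\tilde u_h,\tilde r_h)\in\Sigma_h\times U_h\times R_h$, $$\langle A_{\mu}\sigma_{\mu},\tilde\sigma_h\rangle_\Omega+\langle u_{\mu},\nabla\cdot\tilde\sigma_h\rangle_\Omega-\langle r_{\mu},\mathrm{asym}\,\tilde\sigma_h\rangle_\Omega=\langle g_{u,\mu},\nu\cdot\tilde\sigma_h\rangle_{\partial_u\Omega},$$ $$-\langle\nabla\cdot\sigma_{\mu},\tilde u_h\rangle_\Omega=\langle f_{u,\mu},\tilde u_h\rangle_\Omega,\qquad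 \langle\mathrm{asym}\,\sigma_{\mu},\tilde r_h\rangle_\Omega=0.$$ The last two equations say that $B\sigma_{\mu}=f_{\mu}$. Right-inverse. $S_I:U_h'\times R_h'\to\Sigma_h$ is a fixed linear operator, independent of $\mu$, satisfying $BS_If=f$ for all $f\in U_h'\times R_h'$. (Concretely, $S_I=\Pi^*(B\Pi^* )^{-1}$, where $\Pi^*$ is the inclusion into $\Sigma_h$ of a space of dimension $\dim U_h+\dim R_h$, spanned by degrees of freedom on the mesh facets associated with a spanning tree of the dual graph of the mesh, on which $B$ is invertible.) The operator $S_0:=I-S_IB$ has range $\ker B$. The supremum defining $\epsilon$ is taken in $[0,\infty]$. *)

(* Defs.v *)
From HB Require Import structures.
From mathcomp Require Import all_boot all_order all_algebra.
From mathcomp Require Import all_classical all_reals all_analysis.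
From mathcomp Require Import lra measurable_realfun.
Set Implicit Arguments.
Unset Strict Implicit.
Unset Printing Implicit Defensive.
Import Order.TTheory GRing.Theory Num.Theory numFieldNormedType.Exports.
Local Open Scope classical_set_scope.
Local Open Scope ring_scope.

Section measurable_rV.
Context {R : realType} {n : nat}.

Let coord (i : 'I_n) (x : 'rV[R]_n) : R := x ord0 i.

Let rV_set0 : g_sigma_preimage coord set0.
Proof. exact: sigma_algebra0. Qed.

Let rV_setC A : g_sigma_preimage coord A -> g_sigma_preimage coord (~` A).
Proof. exact: sigma_algebraC. Qed.

Let rV_bigcup (F : _^nat) : (forall i, g_sigma_preimage coord (F i)) ->
  g_sigma_preimage coord (\bigcup_i (F i)).
Proof. exact: sigma_algebra_bigcup. Qed.

(* The Borel sigma-algebra of R^n, generated by the coordinates. *)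
HB.instance Definition _ := @isMeasurable.Build default_measure_display
  'rV[R]_n (g_sigma_preimage coord) rV_set0 rV_setC rV_bigcup.

Lemma measurable_coord (i : 'I_n) :
  measurable_fun [set: 'rV[R]_n] (fun x => x ord0 i).
Proof.
move=> _ Y mY; rewrite setTI; apply: sub_sigma_algebra => /=.
rewrite -bigcup_seq/=; exists i => /=; first by rewrite mem_index_enum.
by exists Y => //; rewrite setTI.
Qed.

Lemma measurable_fun_rV d (T : measurableType d) (f : T -> 'rV[R]_n) :
  (forall i, measurable_fun [set: T] (fun t => f t ord0 i)) ->
  measurable_fun [set: T] f.
Proof.
move=> mf _ Y mY; rewrite setTI.
suff : g_sigma_preimage coord `<=` [set A | measurable (f @^-1` A)] by exact.
apply: smallest_sub.
  split=> /=; first by rewrite preimage_set0.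
    by move=> A mA; rewrite setTD preimage_setC; exact: measurableC.
  by move=> F mF; rewrite preimage_bigcup; exact: bigcup_measurable.
rewrite -bigcup_seq/= => A [i _ [B mB <-]] /=.
by rewrite setTI; have := mf i measurableT B mB; rewrite setTI.
Qed.

End measurable_rV.

Section lebesgue_rV.
Variable R : realType.
Local Open Scope ereal_scope.

Definition rV_cons n (p : R * 'rV[R]_n) : 'rV[R]_n.+1 :=
  row_mx (p.1)%:M p.2.

(* The n-dimensional Lebesgue measure, as an iterated product measure. *)
Fixpoint leb_rV n : set 'rV[R]_n -> \bar R :=
  match n with
  | 0 => \d_(0%R : 'rV[R]_0)
  | n'.+1 => pushforward (lebesgue_measure \x @leb_rV n') (@rV_cons n')
  end.

Lemma rV_cons0 n (p : R * 'rV[R]_n) : rV_cons p ord0 ord0 = p.1.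
Proof.
by rewrite /rV_cons mxE; case: splitP => // j _; rewrite !ord1 mxE mulr1n.
Qed.

Lemma rV_consS n (p : R * 'rV[R]_n) i :
  rV_cons p ord0 (lift ord0 i) = p.2 ord0 i.
Proof.
rewrite /rV_cons mxE; case: splitP => [[[]//]|j].
by rewrite lift0 add1n => -[/val_inj ->].
Qed.

Lemma measurable_rV_cons n : measurable_fun [set: R * 'rV[R]_n] (@rV_cons n).
Proof.
apply: measurable_fun_rV => i; case: (unliftP ord0 i) => [j ->|->].
  under eq_fun do rewrite rV_consS.
  exact: (measurableT_comp (measurable_coord j) measurable_snd).
under eq_fun do rewrite rV_cons0.
exact: measurable_fst.
Qed.


Section leb_rVS.
Variables (n : nat) (m : {sigma_finite_measure set 'rV[R]_n -> \bar R}).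

Let mS := pushforward (lebesgue_measure \x m) (@rV_cons n).

Let mS0 : mS set0 = 0.
Proof. by rewrite /mS /pushforward preimage_set0 measure0. Qed.

Let mpre A : measurable A -> measurable (@rV_cons n @^-1` A).
Proof. by move=> mA; rewrite -[X in measurable X]setTI; exact: measurable_rV_cons. Qed.

Let mS_ge0 A : 0 <= mS A.
Proof. by rewrite /mS /pushforward measure_ge0. Qed.

Let mS_sigma_additive : semi_sigma_additive mS.
Proof.
move=> F mF tF mUF; rewrite /mS /pushforward preimage_bigcup.
apply: measure_semi_sigma_additive.
- by move=> k; exact: mpre.
- apply/trivIsetP => /= i j _ _ ij; rewrite -preimage_setI.
  by move/trivIsetP : tF => /(_ _ _ _ _ ij) ->//; rewrite preimage_set0.
- by rewrite -preimage_bigcup; exact: mpre.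
Qed.

HB.instance Definition _ := isMeasure.Build _ _ _ mS
  mS0 mS_ge0 mS_sigma_additive.

Let head_tail (x : 'rV[R]_n.+1) : R * 'rV[R]_n :=
  (x ord0 ord0, \row_i x ord0 (lift ord0 i)).

Let measurable_head_tail : measurable_fun [set: 'rV[R]_n.+1] head_tail.
Proof.
apply/measurable_fun_pairP; split; first exact: measurable_coord.
apply: measurable_fun_rV => i; under eq_fun do rewrite /= mxE.
exact: measurable_coord.
Qed.

Let rV_consK : cancel (@rV_cons n) head_tail.
Proof.
move=> [a x]; congr pair; first by rewrite rV_cons0.
by apply/rowP => i; rewrite mxE rV_consS.
Qed.

Let mS_sigma_finite : sigma_finite setT mS.
Proof.
have /sigma_finiteP[F [TF ndF Foo]] := sigma_finiteT (@lebesgue_measure R).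
have /sigma_finiteP[G [TG ndG Goo]] := sigma_finiteT m.
exists (fun k => head_tail @^-1` (F k `*` G k)).
  rewrite -preimage_bigcup (_ : \bigcup_i _ = setT) ?preimage_setT//.
  rewrite -setXTT TF TG predeqE => -[x y]; split.
    by move=> [k _ []/= ? ?]; split; exists k.
  move=> [/= [k _ Fkx] [l _ Gly]]; exists (maxn k l) => //; split.
  - by move: x Fkx; exact/subsetPset/ndF/leq_maxl.
  - by move: y Gly; exact/subsetPset/ndG/leq_maxr.
move=> k; have [mF Fk] := Foo k; have [mG Gk] := Goo k; split.
  rewrite -[X in measurable X]setTI; apply: measurable_head_tail => //.
  exact: measurableX.
rewrite /mS /pushforward -comp_preimage (_ : _ \o _ = id); last first.
  by apply/funext => p; rewrite /= rV_consK.
by rewrite preimage_id product_measure1E// lte_mul_pinfty// ge0_fin_numE.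
Qed.

HB.instance Definition _ := @Measure_isSigmaFinite.Build _ _ _ mS mS_sigma_finite.

Lemma leb_rVS : exists m' : {sigma_finite_measure set 'rV[R]_n.+1 -> \bar R},
  mS = m'.
Proof. by exists mS. Qed.

End leb_rVS.

Lemma leb_rV_measure n :
  exists m : {sigma_finite_measure set 'rV[R]_n -> \bar R}, @leb_rV n = m.
Proof.
elim: n => [|n [m mE]] /=; first by exists (\d_(0%R : 'rV[R]_0)).
by rewrite mE; exact: leb_rVS.
Qed.

Section leb_rV_instance.
Variable n : nat.

Let leb0 : @leb_rV n set0 = 0.
Proof. by have [m ->] := leb_rV_measure n. Qed.

Let leb_ge0 A : 0 <= @leb_rV n A.
Proof. by have [m ->] := leb_rV_measure n. Qed.

Let leb_sigma_additive : semi_sigma_additive (@leb_rV n).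
Proof.
by have [m ->] := leb_rV_measure n; exact: measure_semi_sigma_additive.
Qed.

HB.instance Definition _ := isMeasure.Build _ _ _ (@leb_rV n)
  leb0 leb_ge0 leb_sigma_additive.

Let leb_sigma_finite : sigma_finite setT (@leb_rV n).
Proof. by have [m ->] := leb_rV_measure n; exact: sigma_finiteT. Qed.

HB.instance Definition _ :=
  @Measure_isSigmaFinite.Build _ _ _ (@leb_rV n) leb_sigma_finite.

End leb_rV_instance.
End lebesgue_rV.

Section geometry.
Context {R : realType} {n : nat}.
Local Notation E := 'rV[R]_n.+1.

Definition enorm k (x : 'rV[R]_k) : R := Num.sqrt (\sum_i x ord0 i ^+ 2).

Definition bdry (Omega : set E) : set E := closure Omega `\` interior Omega.

Definition hull (P : set E) : set E :=
  [set x | exists k (a : 'I_k -> R) (p : 'I_k -> E),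
    [/\ forall i, 0 <= a i, \sum_i a i = 1, forall i, P (p i) &
        x = \sum_i a i *: p i]].

(* Near each boundary point, in suitable Cartesian coordinates
   z = (z_0, z'), the domain is the strict epigraph z_0 > gamma z' of a
   Lipschitz function gamma. *)
Definition lipschitz_bdry (Omega : set E) : Prop :=
  forall x, bdry Omega x ->
  exists (Q : 'M[R]_n.+1) (gamma : 'rV[R]_n -> R) (L r h : R),
    [/\ Q *m Q^T = 1%:M, 0 < r, 0 < h,
        forall y z, `|gamma y - gamma z| <= L * enorm (y - z) &
        forall y : E, let z : 'rV[R]_(1 + n) := (y - x) *m Q in
          enorm (rsubmx z) < r -> `|z ord0 ord0| < h ->
          (Omega y <-> gamma (rsubmx z) < z ord0 ord0) /\
          (bdry Omega y <-> z ord0 ord0 = gamma (rsubmx z))].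

Definition polytopal (Omega : set E) : Prop :=
  exists m (P : 'I_m -> seq E),
    closure Omega = \bigcup_i hull [set x | x \in P i].

Record lipschitz_polytopal_domain (Omega : set E) : Prop := {
  domain_open : open Omega;
  domain_connected : connected Omega;
  domain_nonempty : Omega !=set0;
  domain_bounded : bounded_set Omega;
  domain_polytopal : polytopal Omega;
  domain_lipschitz : lipschitz_bdry Omega }.

End geometry.

(* A family of n.+1-simplices given by their vertices. *)
Record mesh (R : realType) (n : nat) := Mesh {
  ncell : nat;
  vtx : 'I_ncell -> 'I_n.+2 -> 'rV[R]_n.+1 }.

Section mesh.
Context {R : realType} {n : nat}.
Local Notation E := 'rV[R]_n.+1.
Variable Th : mesh R n.
Implicit Types (T : 'I_(ncell Th)) (i : 'I_n.+2).

Definition vertices T : set E := range (vtx T).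
Definition cell T : set E := hull (vertices T).
(* The facet of T opposite to its i-th vertex. *)
Definition facet T i : set E := hull (vtx T @` [set j | j != i]).

(* The row of barycentric coordinates of x in T is
   row_mx 1 x *m invmx (vertex_mx T). *)
Definition vertex_mx T : 'M[R]_n.+2 :=
  \matrix_j (row_mx 1%:M (vtx T j) : 'rV[R]_(1 + n.+1)).

Definition grad_bary T i : E :=
  (dsubmx (col i (invmx (vertex_mx T)) : 'cV[R]_(1 + n.+1)))^T.

(* Outward unit normal of T on the facet opposite to its i-th vertex, see
   [normalP]. *)
Definition normal T i : E :=
  - ((enorm (grad_bary T i))^-1 *: grad_bary T i).

(* Such a mesh exhibits Omega as polytopal, closure Omega being a union of
   simplices; [mesh_conforming] rules out hanging nodes. *)
Record simplicial_mesh_of (Omega : set E) : Prop := {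
  mesh_nondegenerate : forall T, vertex_mx T \in unitmx;
  mesh_cover : closure Omega = \bigcup_T cell T;
  mesh_inj : forall T T', vertices T = vertices T' -> T = T';
  mesh_conforming : forall T T',
    cell T `&` cell T' = hull (vertices T `&` vertices T') }.

Definition shape_regular (kappa : R) : Prop :=
  forall T, exists (c : E) (rho : R),
    [/\ 0 < rho, [set x | enorm (x - c) <= rho] `<=` cell T &
        forall x y, cell T x -> cell T y -> enorm (x - y) <= kappa * rho].

Definition bfacet (Omega : set E) T i : Prop := facet T i `<=` bdry Omega.

(* Surface integrals over a facet are computed in the affine parametrization
   of the facet by the reference simplex of R^n; [facet_jac] is its Gram
   determinant factor. *)
Definition ref_simplex : set 'rV[R]_n :=
  [set s | (forall j, 0 <= s ord0 j) /\ \sum_j s ord0 j <= 1].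

Definition facet_edges T i : 'M[R]_(n, n.+1) :=
  \matrix_(j < n)
    (vtx T (lift i (lift ord0 j)) - vtx T (lift i ord0)).

Definition facet_param T i (s : 'rV[R]_n) : E :=
  vtx T (lift i ord0) + s *m facet_edges T i.

Definition facet_jac T i : R :=
  Num.sqrt (\det (facet_edges T i *m (facet_edges T i)^T)).

Definition facet_part (G : set E) T i : set 'rV[R]_n :=
  ref_simplex `&` facet_param T i @^-1` G.

Definition surface_measure (Omega G : set E) : \bar R :=
  (\sum_T \sum_(i | `[< bfacet Omega T i >])
    (facet_jac T i)%:E * leb_rV (facet_part G T i))%E.

(* The broken field equal to f T on the interior of each cell T.  The value 0
   on the mesh skeleton is irrelevant, the skeleton being a null set. *)
Definition broken (V : lmodType R) (f : 'I_(ncell Th) -> E -> V) (x : E) : V :=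
  \sum_T (\1_(interior (cell T)) x : R) *: f T x.

End mesh.

Section L2.
Context {R : realType}.
Local Open Scope ereal_scope.

Definition L2 k (D : set 'rV[R]_k) p q (f : 'rV[R]_k -> 'M[R]_(p, q)) : Prop :=
  forall i j, measurable_fun D (fun x => f x i j) /\
    \int[@leb_rV R k]_(x in D) ((f x i j) ^+ 2)%:E < +oo.

Definition ip k (D : set 'rV[R]_k) p q (f g : 'rV[R]_k -> 'M[R]_(p, q)) : R :=
  (\int[@leb_rV R k]_(x in D) (\sum_i \sum_j f x i j * g x i j))%R.

End L2.

Section asym.
Context {R : realType}.

Definition asym2 (s : 'M[R]_2) : 'rV[R]_1 := \row__ (s 1 0 - s 0 1).

Definition asym3 (s : 'M[R]_3) : 'rV[R]_3 :=
  let x : 'I_3 := inord 0 in let y : 'I_3 := inord 1 in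
  let z : 'I_3 := inord 2 in
  \row_k [:: s z y - s y z; s x z - s z x; s y x - s x y]`_k.

(* Only the dimensions n.+1 = 2 and n.+1 = 3 are meaningful. *)
Definition asym n : 'M[R]_n.+1 -> 'rV[R]_('C(n.+1, 2)) :=
  match n with
  | 1 => asym2
  | 2 => asym3
  | _ => fun _ => 0
  end.

End asym.

(* The subspace with membership predicate P, when P is linearly closed. *)
Definition vspace_of (K : fieldType) (V : vectType K) (P : set V) :
    {vspace V} :=
  xget 0%VS [set W : {vspace V} | forall v, v \in W <-> P v].

Section spaces.
Context {R : realType} {n : nat}.
Local Notation E := 'rV[R]_n.+1.
Local Notation mx := 'M[R]_n.+1.
Variables (Omega dOu dOs : set E) (Th : mesh R n).
Local Notation cells := 'I_(ncell Th).

(* An affine matrix field x |-> a.1 + \sum_k x_k a.2_k, given by its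
   coefficients. *)
Definition P1mx : vectType R := (mx * {ffun 'I_n.+1 -> mx})%type.
Definition P1eval (a : P1mx) (x : E) : mx :=
  a.1 + \sum_k x ord0 k *: a.2 k.
(* Row-wise divergence: the derivative of a in direction j is a.2 j. *)
Definition P1div (a : P1mx) : E := \row_i \sum_j a.2 j i j.

Definition bP1 : vectType R := {ffun cells -> P1mx}.
Definition Uh : vectType R := {ffun cells -> 'rV[R]_n.+1}.
Definition Rh : vectType R := {ffun cells -> 'rV[R]_('C(n.+1, 2))}.

(* Trace of the row-wise normal component, taken from the cell T. *)
Definition ntrace (nu : E) (s : bP1) (T : cells) (x : E) : E :=
  nu *m (P1eval (s T) x)^T.

(* Piecewise affine fields whose rows are in H(div): normal components match
   across the interior facets. *)
Definition BDM1 (s : bP1) : Prop :=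
  forall (T T' : cells) i i', T != T' -> facet T i = facet T' i' ->
  forall x, facet T i x ->
    ntrace (normal T i) s T x = ntrace (normal T i) s T' x.

Definition zero_normal (G : set E) (s : bP1) : Prop :=
  forall (T : cells) i, bfacet Omega T i ->
  {ae @leb_rV R n, forall y, facet_part G T i y ->
    ntrace (normal T i) s T (facet_param T i y) = 0}.

(* See [mem_Sigmah]. *)
Definition Sigmah : {vspace bP1} :=
  vspace_of [set s : bP1 | BDM1 s /\ zero_normal dOs s].
Definition Sh : vectType R := subvs_of Sigmah.

Definition stress (s : Sh) : E -> mx := broken (fun T => P1eval (vsval s T)).
Definition div_stress (s : Sh) : E -> E :=
  broken (fun T _ => P1div (vsval s T)).
Definition displacement (u : Uh) : E -> E := broken (fun T _ => u T).
Definition rotation (r : Rh) : E -> 'rV[R]_('C(n.+1, 2)) :=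
  broken (fun T _ => r T).

Definition dual (V : vectType R) : vectType R := 'Hom(V, R^o).
Definition dualUR : vectType R := (dual Uh * dual Rh)%type.
Definition pairing (F : dualUR) (u : Uh) (r : Rh) : R := F.1 u + F.2 r.

(* [linfun f] is f itself when f is linear: see [pairing_opB] and
   [pairing_load] for the defining identities of opB and load. *)
Definition opB : 'Hom(Sh, dualUR) := linfun (fun s : Sh =>
  (linfun (fun u : Uh => - ip Omega (div_stress s) (displacement u) : R^o),
   linfun (fun r : Rh => ip Omega (@asym R n \o stress s) (rotation r) : R^o))).

Definition load (f : E -> E) : dualUR :=
  (linfun (fun u : Uh => ip Omega f (displacement u) : R^o), 0).

Definition L2_bdry (G : set E) (g : E -> E) : Prop :=
  forall (T : cells) i, bfacet Omega T i ->
    L2 (facet_part G T i) (g \o facet_param T i).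

(* The L^2(G) product of g with the outward normal trace of s, for G a subset
   of the boundary. *)
Definition ip_ntrace (G : set E) (g : E -> E) (s : Sh) : R :=
  \sum_(T : cells) \sum_(i | `[< bfacet Omega T i >])
    facet_jac T i * ip (facet_part G T i) (g \o facet_param T i)
      (ntrace (normal T i) (vsval s) T \o facet_param T i).

Definition discrete_solution (A : mx -> mx) (g f : E -> E)
    (x : Sh * Uh * Rh) : Prop :=
  let: (s, u, r) := x in
  [/\ L2 Omega (A \o stress s),
      forall t : Sh,
        ip Omega (A \o stress s) (stress t)
          + ip Omega (displacement u) (div_stress t)
          - ip Omega (rotation r) (@asym R n \o stress t)
        = ip_ntrace dOu g t,
      forall v : Uh,
        - ip Omega (div_stress s) (displacement v) = ip Omega f (displacement v)
    & forall q : Rh, ip Omega (@asym R n \o stress s) (rotation q) = 0].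

End spaces.

Section coefficients.
Context {R : realType} {V : vectType R} {N : nat}.
Variable Phi : N.-tuple V.

(* The Euclidean product of the coefficient vectors in the basis Phi. *)
Definition l2dot (s t : V) : R := \sum_i coord Phi i s * coord Phi i t.
Definition l2norm (s : V) : R := Num.sqrt (l2dot s s).

Definition orthogonal_projection (V0 : {vspace V}) (pi : V -> V) : Prop :=
  forall s, pi s \in V0 /\ forall v, v \in V0 -> l2dot (s - pi s) v = 0.

End coefficients.

Section correction.
Context {K : fieldType} {S D : vectType K}.

Definition S0 (B : 'Hom(S, D)) (SI : 'Hom(D, S)) : 'End(S) :=
  (\1 - (SI \o B))%VF.

Definition correction (SI : 'Hom(D, S)) (pi0 : S -> S) (f : D) (s : S) : S :=
  pi0 (s - SI f) + SI f.

End correction.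

Section lebesgue_rV_lemmas.
Context {R : realType} {n : nat}.
Local Notation mu := (@leb_rV R n).

Lemma open_measurable_rV (A : set 'rV[R]_n) : open A -> measurable A.
Proof.
move=> oA.
pose box (c : 'rV[rat]_n * nat) : set 'rV[R]_n :=
  \bigcap_(i in [set: 'I_n])
    ((fun x => x ord0 i) @^-1` ball (ratr (c.1 ord0 i) : R) (c.2.+1%:R^-1)).
have mbox c : measurable (box c).
  apply: fin_bigcap_measurable => [|i _]; first exact: finite_finset.
  rewrite -[X in measurable X]setTI.
  by apply: measurable_coord => //; by apply: measurable_realfun.open_measurable; apply: ball_open; rewrite invr_gt0.
rewrite (_ : A = \bigcup_c (if `[< box c `<=` A >] then box c else set0)).
  apply: countable_bigcupT_measurable; first exact: countableP.
  by move=> c; case: ifP.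
apply/seteqP; split=> [x Ax|x [c _]]; last by case: asboolP => // + cx; apply.
have /nbhs_ballP[e /= e0 xeA] : nbhs x A by exact: open_nbhs_nbhs.
have [k ke] : exists k, k.+1%:R^-1 < e / 2 :> R.
  by have [k _ /(_ _ (leqnn k))] := near_infty_natSinv_lt (PosNum (divr_gt0 e0 (@ltr0n R 2))); exists k.
have k0 : 0 < k.+1%:R^-1 :> R by rewrite invr_gt0.
have [c cE] : exists c : R, k.+1%:R^-1 = c by exists k.+1%:R^-1.
rewrite cE in ke k0.
have /choice[q qP] (i : 'I_n) :
    exists q : rat, ball (ratr q : R) (c) (x ord0 i).
  have [|q] := @rat_in_itvoo R (x ord0 i - c) (x ord0 i + c).
    by lra.
  rewrite in_itv/= => /andP[q1 q2]; exists q.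
  rewrite /ball/= ltr_norml; apply/andP; split.
    by lra.
  by lra.
exists (\row_i q i, k) => //.
have boxx : box (\row_i q i, k) x by move=> i _ /=; rewrite mxE cE.
case: asboolP => // -[]; apply: subset_trans xeA => y boxy.
split=> // i j; rewrite ord1.
have := qP j; have := boxy j Logic.I; rewrite /= mxE cE.
move=> /ball_sym yq qx; have := ball_triangle (ball_sym qx) (ball_sym yq).
by apply: le_ball; rewrite (splitr e) lerD// ltW.
Qed.

Lemma bounded_rV_coord (D : set 'rV[R]_n) : bounded_set D ->
  exists2 M : R, 0 <= M & forall x, D x -> forall i, `|x ord0 i| <= M.
Proof.
move=> [M [_ DM]]; exists (`|M| + 1); first by rewrite addr_ge0.
move=> x Dx i.
have /(DM _) /(_ _ Dx) : M < `|M| + 1 by rewrite ltr_pwDr// ler_norm.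
by apply: le_trans; rewrite [leRHS]/Num.Def.normr/= mx_normrE (le_bigmax _ _ (ord0, i)).
Qed.

End lebesgue_rV_lemmas.

Lemma leb_rV_box (R : realType) n (M : R) : 0 <= M ->
  let Q := [set x : 'rV[R]_n | forall i, `|x ord0 i| <= M] in
  measurable Q /\ leb_rV Q = ((2 * M) ^+ n)%:E.
Proof.
move=> M0 /=.
have mQ k : measurable [set x : 'rV[R]_k | forall i, `|x ord0 i| <= M].
  rewrite [X in measurable X](_ : _ = \bigcap_(i in [set: 'I_k])
      ((fun x : 'rV[R]_k => x ord0 i) @^-1` [set` `[- M, M]])); last first.
    apply/seteqP; split=> [x xM i _ /=|x xM i].
      by rewrite /= in_itv/= -ler_norml; exact: xM.
    have h : x ord0 i \in `[- M, M] by exact: (xM i Logic.I).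
    by rewrite ler_norml; move: h; rewrite in_itv.
  apply: fin_bigcap_measurable => [|i _]; first exact: finite_finset.
  by rewrite -[X in measurable X]setTI; exact: measurable_coord.
split=> //; elim: n => [|n ih].
  by rewrite /= diracE expr0 mem_set//= => -[].
rewrite /= /pushforward (_ : _ @^-1` _ =
  `[- M, M]%classic `*` [set x : 'rV[R]_n | forall i, `|x ord0 i| <= M]); last first.
  apply/seteqP; split=> [p /= pM|p [/= p1 p2] i].
    split; first by have := pM ord0; rewrite rV_cons0 ler_norml in_itv.
    by move=> i; have := pM (lift ord0 i); rewrite rV_consS.
  case: (unliftP ord0 i) => [j ->|->]; first by rewrite rV_consS.
  by rewrite rV_cons0 ler_norml; move: p1; rewrite in_itv.
rewrite product_measure1E//; last exact: mQ.
transitivity (mule (lebesgue_measure `[- M, M]%classic) ((2 * M) ^+ n)%:E).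
  by rewrite -ih.
rewrite lebesgue_measure_itv/= lte_fin.
case: ltP => [MM|]; first by rewrite -EFinB -EFinM; congr EFin; rewrite exprS; congr (_ * _); lra.
move=> MM; rewrite mul0e (_ : M = 0) ?mulr0 ?expr0n//.
by lra.
Qed.


Section normal_lemmas.
Context {R : realType} {n : nat}.
Variable Th : mesh R n.

Let dotE k (x y : 'rV[R]_k) : (x *m y^T) ord0 ord0 = \sum_i x ord0 i * y ord0 i.
Proof. by rewrite mxE; apply: eq_bigr => i _; rewrite mxE. Qed.

Lemma grad_baryP (T : 'I_(ncell Th)) i j k : vertex_mx T \in unitmx ->
  ((vtx T j - vtx T k) *m (grad_bary T i)^T) ord0 ord0
    = (j == i)%:R - (k == i)%:R.
Proof.
move=> uT.
have bary l : invmx (vertex_mx T) ord0 i + (vtx T l *m (grad_bary T i)^T) ord0 ord0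
    = (l == i)%:R.
  have h : \sum_m vertex_mx T l m * invmx (vertex_mx T) m i = (l == i)%:R.
    have := congr1 (fun A : 'M[R]_n.+2 => A l i) (mulmxV uT).
    by rewrite [LHS]mxE [RHS]mxE.
  rewrite -h big_ord_recl dotE; congr (_ + _).
    by rewrite mxE mxE; case: splitP => // l' _; rewrite !ord1 mxE mul1r.
  apply: eq_bigr => l' _; rewrite [vertex_mx _ _ _]mxE [row_mx _ _ _ _]mxE.
  case: splitP => [[[]//]|l''].
  rewrite lift0 add1n => -[/val_inj <-]; congr (_ * _).
  rewrite /grad_bary !mxE; congr (invmx _ _ _); exact: val_inj.
by rewrite mulmxBl [LHS]mxE [X in _ + X]mxE -(bary j) -(bary k) opprD addrACA subrr add0r.
Qed.

Lemma normalP (T : 'I_(ncell Th)) i : vertex_mx T \in unitmx ->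
  [/\ enorm (normal T i) = 1,
      forall j k, j != i -> k != i ->
        ((vtx T j - vtx T k) *m (normal T i)^T) ord0 ord0 = 0 &
      forall j, j != i -> ((vtx T i - vtx T j) *m (normal T i)^T) ord0 ord0 < 0].
Proof.
move=> uT; pose g := grad_bary T i; pose c := enorm g.
have g2 : \sum_l g ord0 l ^+ 2 >= 0 by apply: sumr_ge0 => l _; exact: sqr_ge0.
have c0 : 0 < c.
  rewrite lt_neqAle sqrtr_ge0 andbT eq_sym; apply/negP.
  rewrite sqrtr_eq0 => g20.
  have /eqP : \sum_l g ord0 l ^+ 2 = 0 by apply/eqP; rewrite eq_le g20 g2.
  rewrite psumr_eq0; last by move=> l _; exact: sqr_ge0.
  move=> /allP gl0.
  have g0 : g = 0.
    apply/rowP => l; rewrite [RHS]mxE; apply/eqP.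
    by have := gl0 l (mem_index_enum _); rewrite /= sqrf_eq0.
  have := grad_baryP i i (lift i ord0) uT.
  rewrite -/g g0 trmx0 mulmx0 mxE eqxx eq_sym (negbTE (neq_lift _ _)) subr0.
  by move/eqP; rewrite eq_sym oner_eq0.
have nE (x : 'rV[R]_n.+1) : (x *m (normal T i)^T) ord0 ord0 =
    - (c^-1 * (x *m g^T) ord0 ord0).
  by rewrite /normal linearN linearZ/= mulmxN -scalemxAr !mxE.
split=> [|j k ji ki|j ji].
- rewrite /enorm (eq_bigr (fun l => c^-1 ^+ 2 * g ord0 l ^+ 2)); last first.
    by move=> l _; rewrite !mxE sqrrN exprMn.
  rewrite -mulr_sumr sqrtrM ?sqr_ge0// sqrtr_sqr gtr0_norm ?invr_gt0//.
  by rewrite mulVf// gt_eqF.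
- by rewrite nE grad_baryP// (negbTE ji) (negbTE ki) subrr mulr0 oppr0.
- by rewrite nE grad_baryP// eqxx (negbTE ji) subr0 mulr1 oppr_lt0 invr_gt0.
Qed.

End normal_lemmas.

Lemma mem_vspace_of (K : fieldType) (V : vectType K) (P : set V) :
  P 0 -> (forall a u v, P u -> P v -> P (a *: u + v)) ->
  forall v, v \in vspace_of P <-> P v.
Proof.
move=> P0 PD.
pose good k := `[< exists2 W : {vspace V}, \dim W = k & forall v, v \in W -> P v >].
have good0 : exists k, good k.
  exists 0; apply/asboolP; exists 0%VS; first exact: dimv0.
  by move=> v /[!memv0] /eqP ->.
have goodb k : good k -> (k <= \dim {:V})%N.
  by move=> /asboolP[W <- _]; exact/dimvS/subvf.
have [k /asboolP[W Wk WP] kmax] := ex_maxnP good0 goodb.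
apply: (@xgetPex _ 0%VS [set W' : {vspace V} | forall v, v \in W' <-> P v]).
exists W => v; split=> [/WP//|Pv].
have WvP u : u \in (W + <[v]>)%VS -> P u.
  by move=> /memv_addP[w /WP Pw [_ /vlineP[a ->] ->]]; rewrite addrC; exact: PD.
have : (\dim (W + <[v]>) <= \dim W)%N.
  by rewrite Wk; apply: kmax; apply/asboolP; exists (W + <[v]>)%VS.
move=> dimle; suff -> : W = (W + <[v]>)%VS by rewrite memvE addvSr.
by apply/eqP; rewrite eqEdim addvSl.
Qed.

Section spaces_lemmas.
Context {R : realType} {n : nat}.
Local Notation E := 'rV[R]_n.+1.
Local Notation mx := 'M[R]_n.+1.
Variables (Omega dOs : set E) (Th : mesh R n).

Lemma P1eval_linear a (u v : P1mx) (x : E) :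
  P1eval (a *: u + v) x = a *: P1eval u x + P1eval v x.
Proof.
rewrite /P1eval/= scalerDr addrACA; congr (_ + _).
rewrite scaler_sumr -big_split; apply: eq_bigr => k _ /=.
by rewrite !ffunE scalerDr !scalerA mulrC.
Qed.

Lemma P1div_linear a (u v : @P1mx R n) : P1div (a *: u + v) = a *: P1div u + P1div v.
Proof.
apply/rowP => i; rewrite !mxE mulr_sumr -big_split; apply: eq_bigr => j _ /=.
by rewrite !ffunE !mxE.
Qed.

Lemma ntrace_linear (nu : E) a (s t : bP1 Th) T x :
  ntrace nu (a *: s + t) T x = a *: ntrace nu s T x + ntrace nu t T x.
Proof.
by rewrite /ntrace !ffunE P1eval_linear raddfD/= linearZ/= mulmxDr -scalemxAr.
Qed.

Lemma mem_Sigmah (s : bP1 Th) :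
  s \in Sigmah Omega dOs Th <-> BDM1 s /\ zero_normal Omega dOs s.
Proof.
have P10 x : P1eval (0 : P1mx) x = 0 :> mx.
  by have := P1eval_linear 1 0 0 x; rewrite scaler0 addr0 scale1r => /eqP; rewrite -subr_eq0 opprD addrA subrr add0r oppr_eq0 => /eqP.
have nt0 nu T x : ntrace nu (0 : bP1 Th) T x = 0.
  by rewrite /ntrace ffunE P10 trmx0 mulmx0.
apply: mem_vspace_of => [|a u v [uB un] [vB vn]]; split.
- by move=> *; rewrite !nt0.
- by move=> T i _; apply: aeW => y _; rewrite nt0.
- move=> T T' i i' TT' F x Fx; rewrite !ntrace_linear.
  by rewrite (uB _ _ _ _ TT' F _ Fx) (vB _ _ _ _ TT' F _ Fx).
- move=> T i bTi; have := vn _ _ bTi; have := un _ _ bTi.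
  apply: filterS2 => y uy vy Gy.
  by rewrite ntrace_linear uy// vy// scaler0 addr0.
Qed.

Lemma broken_linear (V : lmodType R) a (f g : 'I_(ncell Th) -> E -> V) x :
  broken (fun T x => a *: f T x + g T x) x = a *: broken f x + broken g x.
Proof.
rewrite /broken scaler_sumr -big_split; apply: eq_bigr => T _ /=.
by rewrite scalerDr !scalerA mulrC.
Qed.

Lemma stress_linear a (s t : Sh Omega dOs Th) x :
  stress (a *: s + t) x = a *: stress s x + stress t x.
Proof.
rewrite /stress -broken_linear; congr broken.
by apply/funext => T; apply/funext => y; rewrite linearP !ffunE P1eval_linear.
Qed.

Lemma div_stress_linear a (s t : Sh Omega dOs Th) x :
  div_stress (a *: s + t) x = a *: div_stress s x + div_stress t x.
Proof.
rewrite /div_stress -broken_linear; congr broken.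
by apply/funext => T; apply/funext => y; rewrite linearP !ffunE P1div_linear.
Qed.

Lemma displacement_linear a (u v : Uh Th) x :
  displacement (a *: u + v) x = a *: displacement u x + displacement v x.
Proof.
rewrite /displacement -broken_linear; congr broken.
by apply/funext => T; apply/funext => y; rewrite !ffunE.
Qed.

Lemma rotation_linear a (u v : Rh Th) x :
  rotation (a *: u + v) x = a *: rotation u x + rotation v x.
Proof.
rewrite /rotation -broken_linear; congr broken.
by apply/funext => T; apply/funext => y; rewrite !ffunE.
Qed.

Lemma asym_linear a (u v : mx) : asym (a *: u + v) = a *: asym u + asym v.
Proof.
case: (n) u v => [|[|[|m]]] u v /=; try by rewrite scaler0 addr0.
  by apply/rowP => i; rewrite !mxE; lra.
by apply/rowP => i; rewrite !mxE; case: i => [[|[|[|]]]]//= _; rewrite ?mxE; lra.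
Qed.

End spaces_lemmas.

Section L2_lemmas.
Context {R : realType} {k : nat}.
Variable D : set 'rV[R]_k.
Hypothesis mD : measurable D.
Local Notation mu := (@leb_rV R k).

Lemma L2_mul_integrable p q (f g : 'rV[R]_k -> 'M[R]_(p, q)) i j :
  L2 D f -> L2 D g -> mu.-integrable D (EFin \o (fun x => f x i j * g x i j)).
Proof.
move=> /(_ i j)[mf f2] /(_ i j)[mg g2].
have sq (h : 'rV[R]_k -> R) : measurable_fun D h ->
    (\int[mu]_(x in D) (h x ^+ 2)%:E < +oo)%E ->
    mu.-integrable D (EFin \o (fun x => h x ^+ 2)).
  move=> mh h2; apply/integrableP; split.
    by apply/measurable_EFinP; exact: measurable_funX.
  rewrite (eq_integral (fun x => (h x ^+ 2)%:E))// => x _ /=.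
  by rewrite ger0_norm// sqr_ge0.
apply: (le_integrable mD _ _ (integrableD mD (sq _ mf f2) (sq _ mg g2))).
  by apply/measurable_EFinP; exact: measurable_funM.
move=> x _ /=; rewrite lee_fin (ger0_norm (addr_ge0 _ _)) ?sqr_ge0//.
by rewrite ler_norml; nra.
Qed.

Let ip_integrable p q (f g : 'rV[R]_k -> 'M[R]_(p, q)) : L2 D f -> L2 D g ->
  mu.-integrable D (EFin \o (fun x => \sum_i \sum_j f x i j * g x i j)).
Proof.
move=> Lf Lg.
rewrite (_ : _ \o _ =
    fun x => (\sum_i \sum_j (f x i j * g x i j)%:E)%E); last first.
  apply/funext => x; rewrite /= -sumEFin; apply: eq_bigr => i _.
  by rewrite -sumEFin.
apply: integrable_sum => // i _; apply: integrable_sum => // j _.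
exact: L2_mul_integrable.
Qed.

Lemma ipC p q (f g : 'rV[R]_k -> 'M[R]_(p, q)) : ip D f g = ip D g f.
Proof.
apply: eq_Rintegral => x _; apply: eq_bigr => i _; apply: eq_bigr => j _.
exact: mulrC.
Qed.

Lemma ip_linearr p q a (f g h : 'rV[R]_k -> 'M[R]_(p, q)) :
  L2 D f -> L2 D g -> L2 D h ->
  ip D f (fun x => a *: g x + h x) = a * ip D f g + ip D f h.
Proof.
move=> Lf Lg Lh; rewrite /ip -RintegralZl//; last exact: ip_integrable.
rewrite -RintegralD//; last 2 first.
- have := integrableZl mD a (ip_integrable Lf Lg).
  by apply: eq_integrable.
- exact: ip_integrable.
apply: eq_Rintegral => x _; rewrite mulr_sumr -big_split; apply: eq_bigr => i _ /=.
rewrite mulr_sumr -big_split; apply: eq_bigr => j _ /=.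
by rewrite !mxE mulrDr mulrCA.
Qed.

Definition bounded_measurable (f : 'rV[R]_k -> R) : Prop :=
  measurable_fun D f /\ exists M, forall x, D x -> `|f x| <= M.

Lemma bm_cst c : bounded_measurable (cst c).
Proof. by split; [exact: measurable_cst|exists `|c|]. Qed.

Lemma bmD f g : bounded_measurable f -> bounded_measurable g ->
  bounded_measurable (fun x => f x + g x).
Proof.
move=> [mf [M fM]] [mg [N gN]]; split; first exact: measurable_funD.
exists (M + N) => x Dx; rewrite (le_trans (ler_normD _ _))// lerD//.
  exact: fM.
exact: gN.
Qed.

Lemma bmM f g : bounded_measurable f -> bounded_measurable g ->
  bounded_measurable (fun x => f x * g x).
Proof.
move=> [mf [M fM]] [mg [N gN]]; split; first exact: measurable_funM.
exists (M * N) => x Dx; rewrite normrM ler_pM//.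
  exact: fM.
exact: gN.
Qed.

Lemma bm_sum m (f : 'I_m -> 'rV[R]_k -> R) :
  (forall i, bounded_measurable (f i)) ->
  bounded_measurable (fun x => \sum_i f i x).
Proof.
elim: m f => [|m ih] f bf.
  by under [fun x => _]funext do rewrite big_ord0; exact: bm_cst.
under [fun x => _]funext do rewrite big_ord_recl.
by apply: bmD => //; apply: ih.
Qed.

Lemma bm_indic A : measurable A -> bounded_measurable (\1_A).
Proof.
move=> mA; split; first exact: measurable_indic.
by exists 1 => x _; rewrite indicE; case: (_ \in _); rewrite ?normr1 ?normr0.
Qed.

Hypothesis bD : bounded_set D.

Lemma bm_coord i : bounded_measurable (fun x => x ord0 i).
Proof.
split; first by apply: measurable_funTS; exact: measurable_coord.
by have [M _ DM] := bounded_rV_coord bD; exists M => x Dx; exact: DM.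
Qed.

Lemma bm_L2 p q (f : 'rV[R]_k -> 'M[R]_(p, q)) :
  (forall i j, bounded_measurable (fun x => f x i j)) -> L2 D f.
Proof.
move=> bf i j; have [mf _] := bf i j; split => //.
have [m2 [M fM]] := bmM (bf i j) (bf i j).
have [N N0 DN] := bounded_rV_coord bD.
have [mQ Qfin] := leb_rV_box k N0.
have Dfin : (mu D < +oo)%E.
  apply: (@le_lt_trans _ _ (mu [set x : 'rV[R]_k | forall i, `|x ord0 i| <= N])).
    by apply: le_measure; rewrite ?inE.
  by rewrite Qfin ltry.
have := @measurable_bounded_integrable _ _ _ mu _ D mD Dfin m2.
have bd : [bounded (f x i j * f x i j) | x in D].
  exists M; split; first exact: num_real.
  by move=> y My x Dx /=; apply: (le_trans (fM _ Dx)); rewrite ltW.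
move=> /(_ bd) /integrableP[_]; apply: le_lt_trans.
apply: ge0_le_integral => //=.
- by move=> x _; rewrite lee_fin sqr_ge0.
- by apply/measurable_EFinP; exact: measurable_funX.
- by do 2 apply: measurableT_comp => //.
- by move=> x _; rewrite lee_fin expr2 ler_norm.
Qed.

Lemma L2_asym m (f : 'rV[R]_k -> 'M[R]_m.+1) :
  (forall i j, bounded_measurable (fun x => f x i j)) -> L2 D (@asym R m \o f).
Proof.
move=> bf; apply: bm_L2 => // i j; rewrite ord1.
have bfB i1 j1 i2 j2 : bounded_measurable (fun x => f x i1 j1 - f x i2 j2).
  under [fun x => _]funext do rewrite -mulN1r.
  by apply: bmD => //; apply: bmM => //; exact: bm_cst.
case: m f bf bfB j => [|[|[|m]]] f bf bfB j /=.
- by under [fun x => _]funext do rewrite mxE; exact: bm_cst.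
- by under [fun x => _]funext do rewrite mxE; exact: bfB.
- under [fun x => _]funext do rewrite mxE.
  by case: j => [[|[|[|]]]]//= _; exact: bfB.
- by under [fun x => _]funext do rewrite mxE; exact: bm_cst.
Qed.

End L2_lemmas.

Lemma linfun_fun (K : fieldType) (U V : vectType K) (f : U -> V) :
  (forall a u v, f (a *: u + v) = a *: f u + f v) -> forall u, linfun f u = f u.
Proof.
move=> fl u.
pose F : {linear U -> V} := HB.pack f (GRing.isLinear.Build K U V *:%R f fl).
by rewrite -[RHS]/(F u) -[linfun f]/(linfun F) lfunE.
Qed.

Lemma linfun_linear (K : fieldType) (U V : vectType K) a (f g h : U -> V) :
  (forall b u v, f (b *: u + v) = b *: f u + f v) ->
  (forall b u v, g (b *: u + v) = b *: g u + g v) ->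
  (forall b u v, h (b *: u + v) = b *: h u + h v) ->
  (forall u, h u = a *: f u + g u) ->
  linfun h = a *: linfun f + linfun g.
Proof.
move=> fl gl hl hE; apply/lfunP => u.
by rewrite add_lfunE scale_lfunE !linfun_fun.
Qed.

Section operators_lemmas.
Context {R : realType} {n : nat}.
Local Notation E := 'rV[R]_n.+1.
Variables (Omega dOs : set E) (Th : mesh R n).
Hypothesis dom : lipschitz_polytopal_domain Omega.

Let mO : measurable Omega.
Proof. by apply: open_measurable_rV; exact: domain_open dom. Qed.

Let bO : bounded_set Omega.
Proof. exact: domain_bounded dom. Qed.

Lemma bm_broken p q (f : 'I_(ncell Th) -> E -> 'M[R]_(p, q)) i j :
  (forall T, bounded_measurable Omega (fun x => f T x i j)) ->
  bounded_measurable Omega (fun x => broken f x i j).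
Proof.
move=> bf; rewrite [X in bounded_measurable _ X](_ : _ =
    fun x : E => \sum_T (\1_(interior (cell T)) x : R) * f T x i j); last first.
  apply/funext => x; rewrite /broken summxE; apply: eq_bigr => T _.
  by rewrite mxE.
apply: bm_sum => T; apply: bmM => //.
by apply: bm_indic; apply: open_measurable_rV; exact: open_interior.
Qed.

Lemma bm_stress (s : Sh Omega dOs Th) i j :
  bounded_measurable Omega (fun x => stress s x i j).
Proof.
apply: bm_broken => T.
rewrite [X in bounded_measurable _ X](_ : _ = fun x : E => (vsval s T).1 i j +
    \sum_l x ord0 l * (vsval s T).2 l i j); last first.
  apply/funext => x; rewrite /P1eval mxE summxE; congr (_ + _).
  by apply: eq_bigr => l _; rewrite mxE.
apply: bmD; first exact: bm_cst.
by apply: bm_sum => l; apply: bmM; [exact: bm_coord|exact: bm_cst].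
Qed.

Lemma L2_stress (s : Sh Omega dOs Th) : L2 Omega (stress s).
Proof. by apply: bm_L2 => // i j; exact: bm_stress. Qed.

Lemma L2_div_stress (s : Sh Omega dOs Th) : L2 Omega (div_stress s).
Proof. by apply: bm_L2 => // i j; apply: bm_broken => T; exact: bm_cst. Qed.

Lemma L2_displacement (u : Uh Th) : L2 Omega (displacement u).
Proof. by apply: bm_L2 => // i j; apply: bm_broken => T; exact: bm_cst. Qed.

Lemma L2_rotation (r : Rh Th) : L2 Omega (rotation r).
Proof. by apply: bm_L2 => // i j; apply: bm_broken => T; exact: bm_cst. Qed.

Lemma L2_asym_stress (s : Sh Omega dOs Th) : L2 Omega (@asym R n \o stress s).
Proof. by apply: L2_asym => // i j; exact: bm_stress. Qed.

Lemma pairing_opB (s : Sh Omega dOs Th) u r :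
  pairing (opB Omega dOs Th s) u r =
    - ip Omega (div_stress s) (displacement u)
      + ip Omega (@asym R n \o stress s) (rotation r).
Proof.
have linU (t : Sh Omega dOs Th) (a : R) (v w : Uh Th) :
    (- ip Omega (div_stress t) (displacement (a *: v + w)) : R^o) =
    a *: (- ip Omega (div_stress t) (displacement v) : R^o)
      + (- ip Omega (div_stress t) (displacement w) : R^o).
  rewrite (_ : displacement _ =
    fun x => a *: displacement v x + displacement w x); last first.
    by apply/funext => x; exact: displacement_linear.
  rewrite ip_linearr//; [|exact: L2_div_stress|exact: L2_displacement..].
  by rewrite opprD -mulrN.
have linR (t : Sh Omega dOs Th) (a : R) (v w : Rh Th) :
    (ip Omega (@asym R n \o stress t) (rotation (a *: v + w)) : R^o) =
    a *: (ip Omega (@asym R n \o stress t) (rotation v) : R^o)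
      + (ip Omega (@asym R n \o stress t) (rotation w) : R^o).
  rewrite (_ : rotation _ = fun x => a *: rotation v x + rotation w x); last first.
    by apply/funext => x; exact: rotation_linear.
  by rewrite ip_linearr//; [exact: L2_asym_stress|exact: L2_rotation..].
rewrite /pairing /opB linfun_fun/= ?linfun_fun//=.
move=> a v w; apply: (congr2 pair); apply: linfun_linear => // x.
  rewrite (_ : div_stress _ =
    fun x => a *: div_stress v x + div_stress w x); last first.
    by apply/funext => y; exact: div_stress_linear.
  rewrite ipC ip_linearr//; [|exact: L2_displacement|exact: L2_div_stress..].
  by rewrite opprD -mulrN ipC [ip _ _ (div_stress w)]ipC.
rewrite (_ : _ \o stress _ =
    fun x => a *: asym (stress v x) + asym (stress w x)); last first.
  by apply/funext => y; rewrite /= stress_linear asym_linear.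
rewrite ipC ip_linearr//;
  [|exact: L2_rotation|exact: L2_asym_stress|exact: L2_asym_stress].
by rewrite ipC [X in _ + X]ipC.
Qed.

Lemma pairing_load (f : E -> E) (u : Uh Th) (r : Rh Th) : L2 Omega f ->
  pairing (load Omega Th f) u r = ip Omega f (displacement u).
Proof.
move=> Lf; rewrite /pairing /load/= lfunE/= addr0 linfun_fun// => a v w.
rewrite (_ : displacement _ =
  fun x => a *: displacement v x + displacement w x); last first.
  by apply/funext => x; exact: displacement_linear.
by rewrite ip_linearr//; exact: L2_displacement.
Qed.

End operators_lemmas.

(* Main.v *)
(* Since B sigma_mu = f_mu, the vector x := sigma_mu - S_I f_mu equals
   S_0 sigma_mu, so sigma_mu - C(s, mu) is the sum of x - pi_0 x, orthogonal to
   V_0 and of norm at most epsilon, and of pi_0 x - pi_0 (s - S_I f_mu), which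
   lies in V_0 and has norm at most ||sigma_mu - s||.  By orthogonality both the
   contraction and the triangle inequality needed follow from Pythagoras. *)

Require Import Defs.
From HB Require Import structures.
From mathcomp Require Import all_boot all_order all_algebra.
From mathcomp Require Import all_classical all_reals all_analysis.
From mathcomp Require Import ring.
Set Implicit Arguments.
Unset Strict Implicit.
Unset Printing Implicit Defensive.
Import Order.TTheory GRing.Theory Num.Theory numFieldNormedType.Exports.
Local Open Scope classical_set_scope.
Local Open Scope ring_scope.

Section l2norm_lemmas.
Context {R : realType} {V : vectType R} {N : nat}.
Variable Phi : N.-tuple V.
Implicit Types (s t x y : V).

Lemma l2dotBl x s t : l2dot Phi (s - t) x = l2dot Phi s x - l2dot Phi t x.
Proof.
by rewrite /l2dot -sumrB; apply: eq_bigr => i _; rewrite linearB mulrBl.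
Qed.

Lemma l2dot_ge0 s : 0 <= l2dot Phi s s.
Proof. by apply: sumr_ge0 => i _; rewrite -expr2 sqr_ge0. Qed.

Lemma l2norm_ge0 s : 0 <= l2norm Phi s.
Proof. exact: sqrtr_ge0. Qed.

Lemma sqr_l2norm s : l2norm Phi s ^+ 2 = l2dot Phi s s.
Proof. by rewrite sqr_sqrtr ?l2dot_ge0. Qed.

Lemma l2norm_pythagoras s t : l2dot Phi s t = 0 ->
  l2norm Phi (s + t) ^+ 2 = l2norm Phi s ^+ 2 + l2norm Phi t ^+ 2.
Proof.
move=> st0; rewrite !sqr_l2norm.
(* The cross terms [l2dot Phi s t] and [l2dot Phi t s] agree coordinatewise, which gives the factor
   2. *)
transitivity (l2dot Phi s s + l2dot Phi t t + l2dot Phi s t *+ 2).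
  rewrite /l2dot -sumrMnl -!big_split; apply: eq_bigr => i _ /=.
  by rewrite linearD; ring.
by rewrite st0 mul0rn addr0.
Qed.

(** After squaring, Pythagoras leaves only the double product of the two norms as the gap between
    the sides, and this is nonnegative. *)
Lemma l2norm_orthogonal_triangle s t : l2dot Phi s t = 0 ->
  l2norm Phi (s + t) <= l2norm Phi s + l2norm Phi t.
Proof.
move=> st0; rewrite -(@ler_pXn2r _ 2) ?nnegrE ?addr_ge0 ?l2norm_ge0//.
rewrite l2norm_pythagoras// sqrrD lerD2r lerDl.
by rewrite mulrn_wge0// mulr_ge0 ?l2norm_ge0.
Qed.

(** [pi] is a bare function, so the argument works with the difference [pi x - pi y] directly: it is
    one leg of a right triangle with hypotenuse [x - y]. *)
Lemma orthogonal_projection_contraction (V0 : {vspace V}) (pi : V -> V) x y :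
  orthogonal_projection Phi V0 pi ->
  l2norm Phi (pi x - pi y) <= l2norm Phi (x - y).
Proof.
move=> piP; have [px xV0] := piP x; have [py yV0] := piP y.
have pxy : pi x - pi y \in V0 by rewrite rpredB.
(* The residual of the difference is the difference of the residuals of [x] and [y], each orthogonal
   to [V0]. *)
have res0 : l2dot Phi (x - y - (pi x - pi y)) (pi x - pi y) = 0.
  have -> : x - y - (pi x - pi y) = (x - pi x) - (y - pi y).
    by rewrite opprD addrACA -opprD.
  by rewrite l2dotBl xV0// yV0// subrr.
rewrite -(@ler_pXn2r _ 2) ?nnegrE ?l2norm_ge0//.
have := l2norm_pythagoras res0; rewrite subrK => ->.
by rewrite lerDr sqr_ge0.
Qed.

End l2norm_lemmas.

Section correction_lemmas.
Context {R : realType} {S D : vectType R} {N : nat}.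
Variables (Phi : N.-tuple S) (B : 'Hom(S, D)) (SI : 'Hom(D, S)).
Variables (V0 : {vspace S}) (pi0 : S -> S).
Hypothesis piP : orthogonal_projection Phi V0 pi0.

Lemma S0E s : S0 B SI s = s - SI (B s).
Proof. by rewrite /S0 add_lfunE opp_lfunE comp_lfunE id_lfunE. Qed.

(** The projected part lies in [V0], hence has the form [S0 B SI t], which [B] kills because [SI] is
    a right-inverse; only [SI f] contributes to the image under [B]. *)
Lemma correction_constraint f s : (forall g, B (SI g) = g) ->
  (V0 <= limg (S0 B SI))%VS -> B (correction SI pi0 f s) = f.
Proof.
move=> BSI /subvP V0S0; rewrite /correction linearD /= BSI.
have [/V0S0 /memv_imgP[t _ ->] _] := piP (s - SI f).
by rewrite S0E linearB /= BSI subrr add0r.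
Qed.

(** A bound for a single stress, with its own projection residual in place of [epsilon], so that the
    estimate stays in the reals until the supremum is taken. *)
Lemma correction_error f sigma s : B sigma = f ->
  l2norm Phi (sigma - correction SI pi0 f s) <=
    l2norm Phi (sigma - s) + l2norm Phi (S0 B SI sigma - pi0 (S0 B SI sigma)).
Proof.
move=> Bf; rewrite S0E Bf; set x := sigma - SI f; set y := s - SI f.
have xy : sigma - s = x - y by rewrite /x /y opprB subrKA.
have -> : sigma - correction SI pi0 f s = (x - pi0 x) + (pi0 x - pi0 y).
  by rewrite addrA subrK /x /correction opprD addrAC addrA.
have [px xV0] := piP x; have [py _] := piP y.
apply: le_trans (l2norm_orthogonal_triangle (xV0 _ (rpredB px py))) _.
by rewrite addrC xy lerD2r (orthogonal_projection_contraction _ _ piP).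
Qed.

End correction_lemmas.

(** The last two equations of the discrete problem say that both functionals have the same pairing
    with every test pair. *)
Lemma discrete_solution_opB (R : realType) (n : nat)
    (Omega dOu dOs : set 'rV[R]_n.+1) (Th : mesh R n)
    (A : 'M[R]_n.+1 -> 'M[R]_n.+1) (g f : 'rV[R]_n.+1 -> 'rV[R]_n.+1)
    (s : Sh Omega dOs Th) (u : Uh Th) (r : Rh Th) :
  lipschitz_polytopal_domain Omega -> L2 Omega f ->
  discrete_solution dOu A g f (s, u, r) ->
  opB Omega dOs Th s = load Omega Th f.
Proof.
move=> dom Lf [_ _ div_s asym_s].
have pairE v q : pairing (opB Omega dOs Th s) v q = pairing (load Omega Th f) v q.
  by rewrite pairing_opB// pairing_load// div_s asym_s addr0.
rewrite [LHS]surjective_pairing [RHS]surjective_pairing.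
apply: (congr2 pair); apply/lfunP => v.
  (* Testing with one entry zero isolates one component of the functional. *)
  by have := pairE v 0; rewrite /pairing !linear0 !addr0.
by have := pairE 0 v; rewrite /pairing !linear0 !add0r.
Qed.

Theorem lemma5p1 (R : realType) (n : nat) (hdim : n.+1 = 2%N \/ n.+1 = 3%N)
  (Omega : set 'rV[R]_n.+1) (hOmega : lipschitz_polytopal_domain Omega)
  (dOu dOs : set 'rV[R]_n.+1)
  (hbdry : dOu `|` dOs = bdry Omega) (hdisj : dOu `&` dOs = set0)
  (hmeas : measurable dOu)
  (Th : mesh R n) (hTh : simplicial_mesh_of Th Omega)
  (kappa : R) (hkappa : shape_regular Th kappa)
  (hdOu : (0 < surface_measure Th Omega dOu)%E)
  (p : nat) (M : set 'rV[R]_p)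
  (A : 'rV[R]_p -> 'M[R]_n.+1 -> 'M[R]_n.+1)
  (gu fu : 'rV[R]_p -> 'rV[R]_n.+1 -> 'rV[R]_n.+1)
  (hgu : forall mu, M mu -> L2_bdry Omega Th dOu (gu mu))
  (hfu : forall mu, M mu -> L2 Omega (fu mu))
  (sigma : 'rV[R]_p -> Sh Omega dOs Th)
  (u : 'rV[R]_p -> Uh Th) (r : 'rV[R]_p -> Rh Th)
  (hsol : forall mu, M mu ->
    unique (discrete_solution dOu (A mu) (gu mu) (fu mu))
      (sigma mu, u mu, r mu))
  (N : nat) (Phi : N.-tuple (Sh Omega dOs Th)) (hPhi : basis_of fullv Phi)
  (SI : 'Hom(dualUR Th, Sh Omega dOs Th))
  (hSI : forall f : dualUR Th, opB Omega dOs Th (SI f) = f)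
  (V0 : {vspace (Sh Omega dOs Th)})
  (hV0 : (V0 <= limg (S0 (opB Omega dOs Th) SI))%VS)
  (pi0 : Sh Omega dOs Th -> Sh Omega dOs Th)
  (hpi0 : orthogonal_projection Phi V0 pi0) :
  let B := opB Omega dOs Th in
  let S0sigma mu := S0 B SI (sigma mu) in
  let f mu := load Omega Th (fu mu) in
  let C s mu := correction SI pi0 (f mu) s in
  let epsilon : \bar R :=
    ereal_sup [set (l2norm Phi (S0sigma mu - pi0 (S0sigma mu)))%:E | mu in M] in
  forall (s : Sh Omega dOs Th) (mu : 'rV[R]_p), M mu ->
    B (C s mu) = f mu /\
    ((l2norm Phi (sigma mu - C s mu))%:E
       <= (l2norm Phi (sigma mu - s))%:E + epsilon)%E.
Proof.
move=> B S0sigma f C epsilon s mu Mmu; split.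
  exact: correction_constraint hpi0 _ _ hSI hV0.
have [sol _] := hsol mu Mmu.
have Bf : B (sigma mu) = f mu.
  exact: discrete_solution_opB hOmega (hfu mu Mmu) sol.
(* The intermediate bound is a finite real; [epsilon] may be [+oo] and dominates the residual at
   [mu] as an upper bound over [M]. *)
apply: (@le_trans _ _ (l2norm Phi (sigma mu - s) +
    l2norm Phi (S0sigma mu - pi0 (S0sigma mu)))%:E).
  by rewrite lee_fin; exact: correction_error hpi0 _ _ _ Bf.
by rewrite EFinD leeD2l//; apply: ereal_sup_ubound; exists mu.
Qed.
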